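(* Two lollipop graphs $C_{n_1}^{n_2}$ and $C_{n_1'}^{n_2'}$ are isomorphic if and only if they have the same path sequence.
   Context: Graphs are finite and simple. A path of length $h$ in $G$ is a subgraph that is a path with $h$ edges ($h+1$ distinct vertices); paths are undirected, and paths of length $0$ are single vertices. $P_h(G)$ is the number of paths of length $h$ in $G$. The path sequence of $G$ is $P(G)=(P_0(G),P_1(G),\ldots,P_\rho(G))$, where $\rho=\rho(G)$ is the length of a longest path in $G$. The lollipop graph $C_{n_1}^{n_2}$ ($n_1\ge3$, $n_2\ge2$) is obtained from the cycle $C_{n_1}$ on $n_1$ vertices and the path $P_{n_2}$ on $n_2$ vertices by identifying one vertex of $C_{n_1}$ with a pendant (end) vertex $x$ of $P_{n_2}$; thus it has $n_1+n_2-1$ vertices and $x$ has degree $3$ in it. *)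

(* Defs.v *)
From mathcomp Require Import all_boot.

Set Implicit Arguments.
Unset Strict Implicit.
Unset Printing Implicit Defensive.

Record sgraph := SGraph {
  vertex :> finType;
  adj : rel vertex;
  adj_sym : symmetric adj;
  adj_irrefl : irreflexive adj }.

Definition degree (G : sgraph) (x : G) : nat := #|[set y | adj x y]|.

Definition pendant (G : sgraph) (x : G) : bool := degree x == 1.

Definition isomorphic (G H : sgraph) : Prop :=
  exists2 f : G -> H, bijective f & forall x y, adj (f x) (f y) = adj x y.

(* The subgraph (vertex set, edge set) traversed by a walk; the list
   zip s (behead s) consists of the pairs of consecutive vertices of s. *)
Definition walk_subgraph (G : sgraph) (s : seq G) :
    {set G} * {set {set G}} :=
  ([set x in s], [set [set e.1; e.2] | e in zip s (behead s)]).

(* A vertex sequence and its reversal yield the same subgraph, so that paths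
   are undirected. *)
Definition paths (G : sgraph) (h : nat) : {set {set G} * {set {set G}}} :=
  [set walk_subgraph t | t : h.+1.-tuple G & uniq t && sorted (@adj G) t].

Definition path_count (G : sgraph) (h : nat) : nat := #|paths G h|.

(* The bound h < #|G| loses nothing: a path of length h has h + 1 vertices. *)
Definition longest_path (G : sgraph) : nat :=
  \max_(h < #|G| | 0 < path_count G h) h.

Definition path_sequence (G : sgraph) : seq nat :=
  mkseq (path_count G) (longest_path G).+1.

Section PathGraph.
Variable n : nat.

Definition path_adj (i j : 'I_n) : bool := (i.+1 == j) || (j.+1 == i).

Lemma path_adj_sym : symmetric path_adj.
Proof. by move=> i j; rewrite /path_adj orbC. Qed.

Lemma path_adj_irrefl : irreflexive path_adj.
Proof. by move=> i; rewrite /path_adj orbb gtn_eqF. Qed.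

Definition path_graph : sgraph := SGraph path_adj_sym path_adj_irrefl.

End PathGraph.

Section CycleGraph.
Variable n : nat.

Definition cycle_adj (i j : 'I_n) : bool :=
  (i != j) && ((i.+1 == j %[mod n]) || (j.+1 == i %[mod n])).

Lemma cycle_adj_sym : symmetric cycle_adj.
Proof. by move=> i j; rewrite /cycle_adj eq_sym orbC. Qed.

Lemma cycle_adj_irrefl : irreflexive cycle_adj.
Proof. by move=> i; rewrite /cycle_adj eqxx. Qed.

Definition cycle_graph : sgraph := SGraph cycle_adj_sym cycle_adj_irrefl.

End CycleGraph.

Section Identify.
Variables (G H : sgraph) (x : G) (y : H).

(* The disjoint union of G and H with x and y identified: the merged vertex is
   represented by inl x, and y is removed from the copy of H. *)
Definition identify_vertex : finType := (G + {z : H | z != y})%type.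

Definition identify_adj (a b : identify_vertex) : bool :=
  match a, b with
  | inl u, inl v => adj u v
  | inr u, inr v => adj (val u) (val v)
  | inl u, inr v => (u == x) && adj y (val v)
  | inr u, inl v => (v == x) && adj y (val u)
  end.

Lemma identify_adj_sym : symmetric identify_adj.
Proof. by move=> [u|u] [v|v] //=; rewrite adj_sym. Qed.

Lemma identify_adj_irrefl : irreflexive identify_adj.
Proof. by move=> [u|u] /=; rewrite adj_irrefl. Qed.

Definition identify : sgraph := SGraph identify_adj_sym identify_adj_irrefl.

End Identify.

(* The graph C_{n1}^{n2} when y is a pendant vertex of the path; the choice of
   x and y does not matter up to isomorphism. *)
Definition lollipop (n1 n2 : nat) (x : cycle_graph n1) (y : path_graph n2) :
  sgraph := identify x y.

(* Main.v *)
(* With n the length of the cycle, m = n2 - 1 the length of the tail and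
   N = n + m, the lollipop is the path 0, 1, ..., N - 1 with the extra edge
   {0, n - 1}.  For 0 < h < n every vertex starts a path of length h that heads
   for the cycle and then keeps turning in the same direction; these N paths
   are distinct, so P_h >= N.  A path of length n either avoids the extra edge
   (m possibilities) or is a, ..., 1, 0, n - 1, n, ... with a < n - 1, so
   P_n < N.  As P_0 = N, the path sequence determines n and m. *)

Require Import Defs.
From mathcomp Require Import all_boot.
From mathcomp Require Import zify.

Set Implicit Arguments.
Unset Strict Implicit.
Unset Printing Implicit Defensive.

(** * Walk subgraphs and path counts *)

Lemma walk_edgeP (G : sgraph) (x0 : G) (s : seq G) (E : {set G}) :
  reflect (exists2 i, i.+1 < size s & E = [set nth x0 s i; nth x0 s i.+1])
          (E \in (walk_subgraph s).2).
Proof.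
apply: (iffP imsetP) => [[[a b]]|[i lti ->]].
  move=> /(nthP (x0, x0)) [i]; rewrite size_zip size_behead => lti.
  move: (lti); rewrite leq_min ltn_predRL => /andP[_ ltSi].
  rewrite nth_zip_cond size_zip size_behead lti nth_behead => -[<- <-] ->.
  by exists i.
exists (nth x0 s i, nth x0 s i.+1) => //; apply/(nthP (x0, x0)).
have lt_zip : i < size (zip s (behead s)).
  by rewrite size_zip size_behead leq_min ltn_predRL lti ltnW.
by exists i; rewrite // nth_zip_cond lt_zip nth_behead.
Qed.

Lemma walk_subgraph_rev (G : sgraph) (s : seq G) :
  walk_subgraph (rev s) = walk_subgraph s.
Proof.
case: s => [|x0 s0] //; set s := x0 :: s0.
(* One inclusion for every [r] is enough, since [rev] is an involution. *)
suff sub (r : seq G) : (walk_subgraph (rev r)).2 \subset (walk_subgraph r).2.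
  rewrite [LHS]surjective_pairing [RHS]surjective_pairing; congr pair.
    by apply/setP => x; rewrite !inE mem_rev.
  by apply/eqP; rewrite eqEsubset sub -{1}[s]revK sub.
apply/subsetP => E /(walk_edgeP x0) [i]; rewrite size_rev => lti ->.
apply/(walk_edgeP x0); exists (size r - i.+2); first by lia.
by rewrite !nth_rev ?(ltnW lti) // setUC -subSn.
Qed.

Lemma pathsP (G : sgraph) (h : nat) (P : {set G} * {set {set G}}) :
  reflect (exists s : seq G,
             [/\ size s = h.+1, uniq s, sorted (@adj G) s
               & P = walk_subgraph s])
          (P \in paths G h).
Proof.
apply: (iffP imsetP) => [[t /[!inE] /andP[ut st] ->]|[s [/eqP sz us ss ->]]].
  by exists t; rewrite size_tuple.
by exists (Tuple sz); rewrite //= inE us.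
Qed.

Lemma path_count0 (G : sgraph) : path_count G 0 = #|G|.
Proof.
have inj1 : injective (fun x : G => walk_subgraph [:: x]).
  move=> x y /(congr1 fst)/setP/(_ x).
  by rewrite !inE eqxx => /esym/eqP.
rewrite -(card_imset predT inj1); apply: eq_card => P.
apply/pathsP/imsetP => [[[|x [|z s]] [] // _ _ _ ->]|[x _ ->]].
  by exists x.
by exists [:: x].
Qed.

Lemma path_count_gt_size (G : sgraph) (h : nat) : #|G| <= h -> path_count G h = 0.
Proof.
move=> leh; apply/eqP; rewrite cards_eq0; apply/eqP/setP => P; rewrite !inE.
apply/negbTE/pathsP => -[s [sz /card_uniqP us _ _]].
by have := max_card [in s]; rewrite us sz; lia.
Qed.

(** Past the longest path the default value 0 is the true count, so equal path sequences give equal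
    counts at every length. *)
Lemma nth_path_sequence (G : sgraph) (h : nat) :
  nth 0 (path_sequence G) h = path_count G h.
Proof.
have [leh|gth] := leqP h (longest_path G); first by rewrite nth_mkseq.
rewrite nth_default ?size_mkseq //; have [ltG|/path_count_gt_size //] := ltnP h #|G|.
have [//|pos] := posnP (path_count G h).
have := @leq_bigmax_cond _ (fun h : 'I_#|G| => 0 < path_count G h)
          (fun h : 'I_#|G| => nat_of_ord h) (Ordinal ltG) pos.
by rewrite -[X in _ <= X -> _]/(longest_path G) /= leqNgt gth.
Qed.

(** * Invariance of the path sequence under isomorphism *)

Lemma isomorphic_sym (G H : sgraph) : isomorphic G H -> isomorphic H G.
Proof.
move=> [f [g fK gK] fadj]; exists g; first by exists f.
by move=> x y; rewrite -fadj !gK.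
Qed.

Lemma isomorphic_trans (G H K : sgraph) :
  isomorphic G H -> isomorphic H K -> isomorphic G K.
Proof.
move=> [f bf fadj] [g bg gadj]; exists (g \o f); first exact: bij_comp.
by move=> x y; rewrite /= gadj fadj.
Qed.

Lemma walk_subgraph_map (G H : sgraph) (f : G -> H) (s : seq G) :
  walk_subgraph (map f s) =
  (f @: (walk_subgraph s).1, (fun E : {set G} => f @: E) @: (walk_subgraph s).2).
Proof.
case: s => [|x0 s0].
  have -> : walk_subgraph [::] = (set0, set0) :> {set G} * {set {set G}}.
    by congr pair; apply/setP => z; rewrite !inE //; apply/imsetP => -[].
  rewrite !imset0; congr pair; apply/setP => z; rewrite !inE //.
  by apply/imsetP => -[].
set s := x0 :: s0; congr pair.
  apply/setP => z; rewrite inE.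
  by apply/mapP/imsetP => -[x xs ->]; exists x; rewrite ?inE // -?inE in xs *.
apply/setP => E; apply/(walk_edgeP (f x0))/imsetP => [[i]|[F /(walk_edgeP x0)[i lti ->] ->]].
  rewrite size_map => lti ->; exists [set nth x0 s i; nth x0 s i.+1].
    by apply/(walk_edgeP x0); exists i.
  by rewrite imsetU !imset_set1 !(nth_map x0) // ltnW.
exists i; rewrite ?size_map //.
by rewrite imsetU !imset_set1 !(nth_map x0) // ltnW.
Qed.

(** Taking images under [f] of vertex sets and edge sets is injective and sends paths to paths. *)
Lemma isomorphic_path_count_leq (G H : sgraph) (h : nat) :
  isomorphic G H -> path_count G h <= path_count H h.
Proof.
move=> [f /bij_inj injf fadj].
pose F (P : {set G} * {set {set G}}) :=
  (f @: P.1, (fun E : {set G} => f @: E) @: P.2).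
have injF : injective F.
  move=> [V E] [V' E'] [/(imset_inj injf) -> /imset_inj E_eq].
  by rewrite E_eq //; apply: imset_inj.
rewrite /path_count -(card_imset (mem (paths G h)) injF).
apply/subset_leq_card/subsetP => _ /imsetP [P /pathsP [s [sz us ss ->]] ->].
apply/pathsP; exists (map f s); split; rewrite ?size_map ?map_inj_uniq //.
  by rewrite sorted_map (eq_sorted (e' := @adj G)).
by rewrite walk_subgraph_map.
Qed.

Lemma isomorphic_path_count (G H : sgraph) (h : nat) :
  isomorphic G H -> path_count G h = path_count H h.
Proof.
move=> GH; apply/eqP; rewrite eqn_leq isomorphic_path_count_leq //.
exact/isomorphic_path_count_leq/isomorphic_sym.
Qed.

Lemma isomorphic_path_sequence (G H : sgraph) :
  isomorphic G H -> path_sequence G = path_sequence H.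
Proof.
move=> GH; have eqc h : path_count G h = path_count H h.
  exact: isomorphic_path_count.
have eqL : longest_path G = longest_path H.
  rewrite /longest_path -!path_count0 eqc.
  by apply: eq_bigl => i; rewrite eqc.
by rewrite /path_sequence eqL; apply: eq_mkseq.
Qed.

(** * The lollipop as a path with a chord *)

Definition consec (i j : nat) : bool := (i.+1 == j) || (j.+1 == i).

(** The conjunct [i != j] rules out a loop at 0 when [n = 1], so that the graph below is simple for
    every [n]. *)
Definition chord (n i j : nat) : bool :=
  (i != j) && ((i == 0) && (j.+1 == n) || (j == 0) && (i.+1 == n)).

Section ChordedPath.
Variables n m : nat.

Definition chorded_adj (i j : 'I_(n + m)) : bool := consec i j || chord n i j.

Lemma chorded_adj_sym : symmetric chorded_adj.
Proof. by move=> i j; rewrite /chorded_adj /consec /chord; lia. Qed.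

Lemma chorded_adj_irrefl : irreflexive chorded_adj.
Proof. by move=> i; rewrite /chorded_adj /consec /chord; lia. Qed.

Definition chorded_path : sgraph := SGraph chorded_adj_sym chorded_adj_irrefl.

End ChordedPath.

(** An interior vertex would have two distinct neighbours, [y - 1] and [y + 1]. *)
Lemma pendant_path_graph (n : nat) (y : path_graph n) :
  pendant y -> y = 0 :> nat \/ y.+1 = n.
Proof.
rewrite /pendant /degree => /cards1P [z Ez]; have ltyn := ltn_ord y.
have [|y_gt0] := posnP y; first by left.
right; apply/eqP; rewrite eqn_leq ltyn leqNgt; apply/negP => ltSy.
have ltPy : y.-1 < n by lia.
have : Ordinal ltSy \in [set z] by rewrite -Ez inE /= /path_adj /= eqxx.
have : Ordinal ltPy \in [set z] by rewrite -Ez inE /= /path_adj /= prednK ?eqxx ?orbT.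
by rewrite !inE => /eqP <- /eqP /(congr1 val) /=; lia.
Qed.

Lemma cycle_adjE (n : nat) (i j : 'I_n) :
  3 <= n -> cycle_adj i j = consec i j || chord n i j.
Proof.
move=> n3; have := ltn_ord i; have := ltn_ord j; rewrite /cycle_adj -val_eqE /=.
have mod_succ (a b : nat) : a < n -> b < n ->
    (a.+1 == b %[mod n]) = (a.+1 == b) || (a.+1 == n) && (b == 0).
  move=> lta ltb; rewrite (modn_small ltb).
  have [ltSa|geSa] := ltnP a.+1 n; first by rewrite modn_small; lia.
  by have -> : a.+1 = n; [lia|rewrite modnn; lia].
by move=> ltj lti; rewrite !mod_succ // /consec /chord; lia.
Qed.

Lemma lollipop_isomorphic (n1 n2 : nat) (x : cycle_graph n1) (y : path_graph n2) :
  3 <= n1 -> pendant y -> isomorphic (lollipop x y) (chorded_path n1 n2.-1).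
Proof.
move=> n3 /pendant_path_graph yend; have ltx := ltn_ord x; have lty := ltn_ord y.
(* The cycle is rotated so that [x] lands on [n1 - 1]. A tail vertex is placed by its distance from
   [y]: with truncated subtraction the sum is the absolute difference, and it determines the vertex
   because [y] is an end. *)
pose pos (a : lollipop x y) : nat := match a with
  | inl u => if u <= x then u + (n1.-1 - x) else u - x.+1
  | inr z => n1.-1 + ((val z - y) + (y - val z)) end.
have pos_lt a : pos a < n1 + n2.-1.
  case: a => [u|[z zy]] /=; first by have := ltn_ord u; case: ifP; lia.
  have := ltn_ord z; lia.
pose f a : chorded_path n1 n2.-1 := Ordinal (pos_lt a).
have injf : injective f.
  move=> a b /(congr1 val) /=; case: a b => [u|[z zy]] [v|[w wy]] /=.
  - move=> eqp; congr inl; apply: val_inj => /=; move: eqp.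
    have := ltn_ord u; have := ltn_ord v; case: ifP; case: ifP; lia.
  - have wy' : w != y :> nat by exact: wy.
    by have := ltn_ord u; case: ifP; lia.
  - have zy' : z != y :> nat by exact: zy.
    by have := ltn_ord v; case: ifP; lia.
  - move=> eqp; congr inr; do 2!apply: val_inj => /=; move: eqp.
    have := ltn_ord z; have := ltn_ord w; lia.
exists f.
  apply: inj_card_bij injf _.
  rewrite card_ord card_sum card_sig card_ord leq_add2l.
  by rewrite -[X in X.-1](card_ord n2) cardC1.
move=> a b; rewrite /= /chorded_adj /=.
case: a b => [u|[z zy]] [v|[w wy]] /=.
- rewrite cycle_adjE // /consec /chord.
  have := ltn_ord u; have := ltn_ord v; case: ifP; case: ifP; lia.
- have wy' : w != y :> nat by exact: wy.
  rewrite -!val_eqE /path_adj /= /consec /chord.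
  have := ltn_ord u; have := ltn_ord w; case: ifP; lia.
- have zy' : z != y :> nat by exact: zy.
  rewrite -!val_eqE /path_adj /= /consec /chord.
  have := ltn_ord v; have := ltn_ord z; case: ifP; lia.
- have wy' : w != y :> nat by exact: wy.
  have zy' : z != y :> nat by exact: zy.
  rewrite /path_adj /= /consec /chord.
  have := ltn_ord z; have := ltn_ord w; lia.
Qed.

(** * Lower bound for lengths below the cycle length *)

Lemma set2_eq (T : finType) (a b c d : T) :
  [set a; b] = [set c; d] -> (a = c /\ b = d) \/ (a = d /\ b = c).
Proof.
move=> E; have := set22 c d; have := set21 c d; rewrite -E.
have := set22 a b; have := set21 a b; rewrite {1 2}E.
by move=> /set2P[]Ea /set2P[]Eb /set2P[]Ec /set2P[]Ed; subst; auto.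
Qed.

Lemma path_count_chorded_geq (n m h : nat) :
  3 <= n -> 0 < h < n -> n + m <= path_count (chorded_path n m) h.
Proof.
move=> n3 /andP[h0 hn].
(* Position [i] of the walk from [v]: it descends to 0, crosses the chord to [n - 1] and descends
   again. *)
have step_lt (v : 'I_(n + m)) (i : 'I_h.+1) :
    (if i <= v then v - i else v + n - i) < n + m.
  by have := ltn_ord v; have := ltn_ord i; case: ifP; lia.
pose g v i : chorded_path n m := Ordinal (step_lt v (inord i)).
have gE v i : i <= h -> g v i = (if i <= v then v - i else v + n - i) :> nat.
  by move=> lei; rewrite /= inordK.
(* From here on [g] is known only through [gE], which hides [inord]. *)
move: g gE => g gE.
pose w (v : chorded_path n m) := mkseq (g v) h.+1.
have inj_w : injective (fun v => walk_subgraph (w v)).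
  move=> v v' eqw.
  have memw u i : i <= h -> g u i \in (walk_subgraph (w u)).1.
    by move=> lei; rewrite inE; apply/mapP; exists i; rewrite ?mem_iota.
  have memwP u z : z \in (walk_subgraph (w u)).1 -> exists2 i, i <= h & z = g u i.
    by rewrite inE => /mapP[i]; rewrite mem_iota => lti ->; exists i.
  have start u : g u 0 = u by apply: val_inj; rewrite /= gE // subn0.
  (* Each start lies on the other walk, and the end of [w v] has some position [j] on [w v']; the
     rest is arithmetic on these positions. *)
  have [i lei /(congr1 val)] : exists2 i, i <= h & v = g v' i.
    by apply: memwP; rewrite -eqw -{1}[v]start memw.
  have [i' lei' /(congr1 val)] : exists2 i, i <= h & v' = g v i.
    by apply: memwP; rewrite eqw -{1}[v']start memw.
  have [j lej eqj] : exists2 j, j <= h & g v h = g v' j.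
    by apply: memwP; rewrite -eqw memw.
  move: (congr1 val eqj); rewrite /= !gE // => vj v'i' vi.
  apply: val_inj; move: vj v'i' vi => /=.
  (* If the ends agree, [v] and [v'] are equal or differ by [n]. In the second case the smaller one
     is below [n], its walk stays below [n], and it cannot reach the larger one. *)
  have [->|neqj] := eqVneq j h; first by do ?case: ifP; lia.
  (* otherwise the last vertex of [w v] would be followed in [w v'] by its
     predecessor in [w v], contradicting [3 <= n] *)
  have : [set g v' j; g v' j.+1] \in (walk_subgraph (w v)).2.
    rewrite eqw; apply/(walk_edgeP v); exists j; first by rewrite size_mkseq; lia.
    by rewrite !nth_mkseq //; lia.
  case/(walk_edgeP v) => k; rewrite size_mkseq => ltk.
  rewrite !nth_mkseq ?(ltnW ltk) //.
  by case/set2_eq => -[/(congr1 val) /= + /(congr1 val) /=]; rewrite !gE //; do ?case: ifP; lia.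
rewrite -[X in X <= _]card_ord -(card_imset predT inj_w).
apply/subset_leq_card/subsetP => _ /imsetP[v _ ->]; apply/pathsP.
exists (w v); split; rewrite ?size_mkseq //.
  apply/(uniqP v) => i j; rewrite !inE size_mkseq => lti ltj.
  rewrite !nth_mkseq // => /(congr1 val) /=.
  by rewrite !gE //; do ?case: ifP; lia.
apply/(sortedP v) => i; rewrite size_mkseq => lti.
rewrite !nth_mkseq ?(ltnW lti) // /= /chorded_adj !gE; try lia.
by have := ltn_ord v; rewrite /consec /chord; do ?case: ifP; lia.
Qed.

(** * Upper bound at the cycle length *)

Lemma sorted_succ_iota (x : nat) (s : seq nat) :
  sorted (fun i j => i.+1 == j) (x :: s) -> x :: s = iota x (size s).+1.
Proof.
elim: s x => [|y s IH] x //= /andP[/eqP <- ps].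
by rewrite [in LHS]IH.
Qed.

(** A change of direction would step from some vertex to a neighbour and straight back, against
    [uniq]. *)
Lemma uniq_sorted_consec (s : seq nat) : uniq s -> sorted consec s ->
  sorted (fun i j => i.+1 == j) s \/ sorted (fun i j => j.+1 == i) s.
Proof.
elim: s => [|x [|y s] IH] /=; [by left|by left|move=> /andP[xs us] /andP[cxy ps]].
have {IH us ps} := IH us ps; case: s xs => [|z s] /= xs.
  by move: cxy; rewrite /consec => /orP[->|->] _; [left|right].
move: cxy xs; rewrite /consec !inE => /orP[]/eqP E xs [/andP[/eqP Ez ps]|/andP[/eqP Ez ps]].
- by left; rewrite ps; lia.
- by lia.
- by lia.
- by right; rewrite ps; lia.
Qed.

Lemma sorted_relU_split (T : Type) (r1 r2 : rel T) (s : seq T) :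
  sorted (fun x y => r1 x y || r2 x y) s ->
  sorted r1 s \/ exists p a b q, s = p ++ a :: b :: q /\ r2 a b.
Proof.
elim: s => [|x [|y s] IH] /=; [by left|by left|].
move=> /andP[/orP[rxy|rxy] /IH IHs]; last by right; exists [::], x, y, s.
case: IHs => [ps|[p [a [b [q [-> rab]]]]]]; first by left; rewrite rxy.
by right; exists (x :: p), a, b, q.
Qed.

(** One index covers both kinds of candidates: [k < m] is the run from [k] to [k + n], and
    [k = m + a] is the descent from [a] to 0 followed by the ascent from [n - 1], with
    [(a + 1) + (n - a)] vertices. *)
Definition long_path (n m k : nat) : seq nat :=
  if k < m then iota k n.+1
  else rev (iota 0 (k - m).+1) ++ iota n.-1 (n - (k - m)).

Lemma long_pathP (n m : nat) (s : seq nat) :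
    3 <= n -> size s = n.+1 -> uniq s -> all (fun i => i < n + m) s ->
    sorted (fun i j => consec i j || chord n i j) s ->
  exists2 k, k < (n + m).-1 & s = long_path n m k \/ rev s = long_path n m k.
Proof.
move=> n3 sz us alls ss.
have iota_case r : size r = n.+1 -> all (fun i => i < n + m) r ->
    sorted (fun i j => i.+1 == j) r ->
    exists2 k, k < (n + m).-1 & r = long_path n m k.
  case: r => [|x r] // szr allr /sorted_succ_iota E.
  (* The last vertex [x + n] is below [n + m], which gives [x < m]. *)
  move: allr; rewrite E; case: szr => -> => /allP/(_ (x + n)).
  rewrite mem_iota => /(_ _)/[dup] xn.
  have {}xn : x < m by have := xn; lia.
  by exists x; rewrite /long_path ?xn //; lia.
have [sc|[p [a [b [q [E ab]]]]]] := sorted_relU_split ss.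
  have [up|down] := uniq_sorted_consec us sc.
    by have [k] := iota_case s sz alls up; exists k => //; left.
  have [||| k] := iota_case (rev s); rewrite ?size_rev ?all_rev ?rev_sorted //.
  by exists k => //; right.
(* After a reversal if necessary, the chord is crossed from 0 to [n - 1]. *)
suff chord_case r p' q' : r = p' ++ 0 :: n.-1 :: q' ->
    size r = n.+1 -> uniq r ->
    sorted (fun i j => consec i j || chord n i j) r ->
    exists2 k, k < (n + m).-1 & r = long_path n m k.
  have ssr : sorted (fun i j => consec i j || chord n i j) (rev s).
    rewrite rev_sorted (eq_sorted _ (e' := fun i j => consec i j || chord n i j)) //.
    by move=> i j; rewrite /consec /chord; lia.
  have : (a = 0 /\ b = n.-1) \/ (a = n.-1 /\ b = 0) by move: ab; rewrite /chord; lia.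
  case=> -[Ea Eb]; subst a b.
    by have [k] := chord_case s p q E sz us ss; exists k => //; left.
  have [|||| k] := chord_case (rev s) (rev q) (rev p); rewrite ?size_rev ?rev_uniq //.
    by rewrite E rev_cat !rev_cons -!cats1 -!catA.
  by exists k => //; right.
move=> {a b p q s sz us alls ss iota_case E ab} Er szr ur sr.
(* A walk missing one end of the chord uses only unit steps. This applies to the part before the
   crossing, which misses [n - 1], and to the part after it, which misses 0. *)
have consec_avoid c t : (c == 0) || (c == n.-1) -> c \notin t ->
    sorted (fun i j => consec i j || chord n i j) t -> sorted consec t.
  move=> cE ct; apply: (@sub_in_sorted _ (predC1 c)); last first.
    by apply/allP => i it; apply: contraNneq ct => <-.
  by move=> i j; rewrite !inE /consec /chord; lia.
(* Read backwards from 0, the first part can only ascend. *)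
have pE : rev (rcons p' 0) = iota 0 (size p').+1.
  have Er' : r = rcons p' 0 ++ n.-1 :: q' by rewrite Er cat_rcons.
  move: ur sr; rewrite Er' cat_uniq => /and3P[up /hasPn /(_ n.-1)].
  rewrite inE eqxx => /(_ isT) np _ /(@cat_sorted2 _ _ (rcons p' 0))[sp _].
  have {}sp : sorted consec (rev (rcons p' 0)).
    rewrite rev_sorted (eq_sorted _ (e' := consec)) ?(consec_avoid n.-1) ?eqxx ?orbT //.
    by move=> i j; rewrite /consec; lia.
  have := uniq_sorted_consec _ sp; rewrite rev_uniq => /(_ up).
  rewrite rev_rcons -(size_rev p') => -[/sorted_succ_iota //|].
  by case: (rev p') => //= y t /andP[].
have pq c : c \in rcons p' 0 -> c \notin n.-1 :: q'.
  move: ur; rewrite Er -cat_rcons cat_uniq => /and3P[_ /hasPn H _] cp.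
  by apply/negP => /H /=; rewrite cp.
(* The first part consists of 0, ..., [size p'] and must miss [n - 1]. *)
have lt_p : (size p').+1 < n.
  rewrite ltnNge; apply/negP => le_n.
  have /pq : n.-1 \in rcons p' 0 by rewrite -mem_rev pE mem_iota; lia.
  by rewrite inE eqxx.
have uq : uniq (n.-1 :: q') by move: ur; rewrite Er -cat_rcons cat_uniq => /and3P[].
have sq : sorted consec (n.-1 :: q').
  apply: (consec_avoid 0) => //; first by rewrite pq // mem_rcons mem_head.
  by move: sr; rewrite Er -cat_rcons => /cat_sorted2[].
have qE : n.-1 :: q' = iota n.-1 (size q').+1.
  have [/sorted_succ_iota //|down] := uniq_sorted_consec uq sq.
  (* both halves would lie on the cycle, which has only n vertices *)
  suff : {subset r <= iota 0 n}.
    by move=> /(uniq_leq_size ur); rewrite szr size_iota ltnn.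
  move=> i; rewrite Er -cat_rcons mem_cat -mem_rev pE !mem_iota.
  have /allP le_q : all (fun i => i <= n.-1) q'.
    apply: (@order_path_min _ geq); first by move=> b c d /=; lia.
    by apply: sub_path down => b c /=; lia.
  by rewrite inE => /or3P[|/eqP ->|/le_q]; lia.
(* The descent to 0 starts at the vertex [size p']. *)
exists (m + size p'); first by lia.
rewrite /long_path ifN -?leqNgt ?leq_addr // addKn -pE revK Er -cat_rcons qE.
congr (_ ++ iota _ _).
by move: szr; rewrite Er size_cat /=; lia.
Qed.

Lemma path_count_chorded_ltn (n m : nat) :
  3 <= n -> path_count (chorded_path n m) n < n + m.
Proof.
move=> n3; pose G := chorded_path n m.
(* [insub] drops numbers that are not vertices: a candidate running off the tail gives a spurious
   entry, harmless for an upper bound. *)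
pose C := [seq walk_subgraph (pmap insub (long_path n m k) : seq G)
          | k <- iota 0 (n + m).-1].
have : size C < n + m by rewrite size_map size_iota; lia.
apply: leq_ltn_trans; apply: leq_trans (card_size C).
apply/subset_leq_card/subsetP => _ /pathsP [s [sz us ss ->]].
have pmap_valK (t : seq G) : pmap insub (map val t) = t by exact: (map_pK valK).
have [||||k ltk] := @long_pathP n m (map val s) n3; rewrite ?size_map //.
- by rewrite map_inj_uniq //; apply: val_inj.
- by rewrite all_map; apply/allP => i _; apply: ltn_ord.
- by rewrite sorted_map.
rewrite -map_rev => E; apply/mapP; exists k; first by rewrite mem_iota.
by case: E => <-; rewrite pmap_valK ?walk_subgraph_rev.
Qed.

(** * Recovering the parameters from the counts *)

Lemma path_count_chorded_inj (n m n' m' : nat) : 3 <= n -> 3 <= n' ->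
  (forall h, path_count (chorded_path n m) h = path_count (chorded_path n' m') h) ->
  n = n' /\ m = m'.
Proof.
move=> n3 n3' eqc; have := eqc 0; rewrite !path_count0 !card_ord => eqN.
(* The smaller cycle length separates the graphs: at that length the count is below the common order
   for one graph and at least that order for the other. *)
have [lt|lt|] := ltngtP n n'; last by lia.
- have := path_count_chorded_ltn m n3; rewrite eqc.
  by have := @path_count_chorded_geq n' m' n; lia.
- have := path_count_chorded_ltn m' n3'; rewrite -eqc.
  by have := @path_count_chorded_geq n m n'; lia.
Qed.

Theorem corollary11 (n1 n2 n1' n2' : nat)
    (hn1 : 3 <= n1) (hn2 : 2 <= n2) (hn1' : 3 <= n1') (hn2' : 2 <= n2')
    (x : cycle_graph n1) (y : path_graph n2) (hy : pendant y)
    (x' : cycle_graph n1') (y' : path_graph n2') (hy' : pendant y') :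
  isomorphic (lollipop x y) (lollipop x' y') <->
  path_sequence (lollipop x y) = path_sequence (lollipop x' y').
Proof.
split=> [|eqP]; first exact: isomorphic_path_sequence.
have iso := lollipop_isomorphic x hn1 hy.
have iso' := lollipop_isomorphic x' hn1' hy'.
have [||h|E1 E2] := @path_count_chorded_inj n1 n2.-1 n1' n2'.-1 => //.
  rewrite -(isomorphic_path_count h iso) -(isomorphic_path_count h iso').
  by rewrite -!nth_path_sequence eqP.
apply: isomorphic_trans iso _; rewrite E1 E2; exact: isomorphic_sym.
Qed.
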